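(* For each of the following pairs $(L,\ell)$ and every $\mathcal{L}(\Box,\mathbf{I})$-formula $A$, we have $L \vdash A$ if and only if $\ell \vdash A$: (1) $L \in \{\mathbf{IL}^-, \mathbf{IL}^-(\mathbf{J5})\}$, $\ell = \mathbf{il}^-$; (2) $L = \mathbf{IL}^-(\mathbf{J1})$, $\ell = \mathbf{il}^-(\mathbf{J1}^u)$; (3) $L \in \{\mathbf{IL}^-(\mathbf{J4}_+), \mathbf{IL}^-(\mathbf{J4}_+,\mathbf{J5}), \mathbf{IL}^-(\mathbf{J2}_+), \mathbf{IL}^-(\mathbf{J2},\mathbf{J4}_+)\}$, $\ell = \mathbf{il}^-(\mathbf{I2})$; (4) $L = \mathbf{IL}^-(\mathbf{J1},\mathbf{J5})$, $\ell = \mathbf{il}^-(\mathbf{J15}^u)$; (5) $L \in \{\mathbf{IL}^-(\mathbf{J1},\mathbf{J4}_+), \mathbf{CL}\}$, $\ell = \mathbf{il}^-(\mathbf{J1}^u,\mathbf{I2})$; (6) $L = \mathbf{IL}^-(\mathbf{J1},\mathbf{J4}_+,\mathbf{J5})$, $\ell = \mathbf{il}^-(\mathbf{J15}^u,\mathbf{I2})$; (7) $L = \mathbf{IL}^-(\mathbf{J2}_+,\mathbf{J5})$, $\ell = \mathbf{il}^-(\mathbf{I2},\mathbf{I3})$; (8) $L = \mathbf{IL}$, $\ell = \mathbf{il}^-(\mathbf{J1}^u,\mathbf{I2},\mathbf{I3})$; (9) $L \in \{\mathbf{IL}^-(\mathbf{J4}), \mathbf{IL}^-(\mathbf{J4},\mathbf{J5}),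 \mathbf{IL}^-(\mathbf{J2})\}$, $\ell = \mathbf{il}^-(\mathbf{I4})$; (10) $L = \mathbf{IL}^-(\mathbf{J1},\mathbf{J4})$, $\ell = \mathbf{il}^-(\mathbf{J1}^u,\mathbf{I4})$; (11) $L = \mathbf{IL}^-(\mathbf{J1},\mathbf{J4},\mathbf{J5})$, $\ell = \mathbf{il}^-(\mathbf{J15}^u,\mathbf{I4})$; (12) $L = \mathbf{IL}^-(\mathbf{J2},\mathbf{J5})$, $\ell = \mathbf{il}^-(\mathbf{J25}^u,\mathbf{I4})$; (13) $L = \mathbf{IL}^-(\mathbf{J2},\mathbf{J4}_+,\mathbf{J5})$, $\ell = \mathbf{il}^-(\mathbf{I2},\mathbf{J25}^u)$.
   Context: The language $\mathcal{L}(\Box,\rhd)$ consists of countably many propositional variables, $\bot$, $\to$, the unary modal operator $\Box$ and the binary modal operator $\rhd$; $\top,\neg,\land,\lor,\leftrightarrow$ are defined as usual and $\Diamond A :\equiv \neg\Box\neg A$. $\rhd$ binds weaker than $\neg,\land,\lor,\Box,\Diamond$ but stronger than $\to$. Put $\mathbf{I}A :\equiv \top \rhd A$. The language $\mathcal{L}(\Box,\mathbf{I})$ has formulas built from propositional variables and $\bot$ by $\to$, $\Box$ and $\mathbf{I}$; via the abbreviation these are also $\mathcal{L}(\Box,\rhd)$-formulas. The logic $\mathbf{IL}^-$ has as axioms all tautologies of $\mathcal{L}(\Box,\rhd)$, $\mathbf{G2}$: $\Box(A\to B)\to(\Box A\to\Box B)$, $\mathbf{G3}$: $\Box(\Box A\to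 A)\to\Box A$, $\mathbf{J3}$: $(A\rhd C)\land(B\rhd C)\to(A\lor B)\rhd C$, $\mathbf{J6}$: $\Box A\leftrightarrow(\neg A\rhd\bot)$; its rules are Modus Ponens, Necessitation ($A/\Box A$), $\mathbf{R1}$: from $A\to B$ infer $(C\rhd A)\to(C\rhd B)$, and $\mathbf{R2}$: from $A\to B$ infer $(B\rhd C)\to(A\rhd C)$. Further schemata: $\mathbf{J1}$: $\Box(A\to B)\to A\rhd B$; $\mathbf{J2}$: $(A\rhd B)\land(B\rhd C)\to A\rhd C$; $\mathbf{J2}_+$: $(A\rhd(B\lor C))\land(B\rhd C)\to A\rhd C$; $\mathbf{J4}$: $A\rhd B\to(\Diamond A\to\Diamond B)$; $\mathbf{J4}_+$: $\Box(A\to B)\to(C\rhd A\to C\rhd B)$; $\mathbf{J5}$: $\Diamond A\rhd A$. For a logic $L$ and schemata $\Sigma_1,\dots,\Sigma_k$, $L(\Sigma_1,\dots,\Sigma_k)$ is the logic obtained by adding these schemata as axioms (same rules). $\mathbf{CL} := \mathbf{IL}^-(\mathbf{J1},\mathbf{J2}_+)$ and $\mathbf{IL} := \mathbf{IL}^-(\mathbf{J1},\mathbf{J2}_+,\mathbf{J5})$. The logic $\mathbf{il}^-$ has as axioms all tautologies of $\mathcal{L}(\Box,\mathbf{I})$, $\mathbf{G2}$, $\mathbf{G3}$ (for $\mathcal{L}(\Box,\mathbf{I})$-formulas) and $\mathbf{J6}^u$: $\Box\bot\leftrightarrow\mathbf{I}\bot$; its rules are Modus Ponens, Necessitation and $\mathbf{R}^u$: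 from $A\to B$ infer $\mathbf{I}A\to\mathbf{I}B$. Further schemata: $\mathbf{I2}$: $\Box(A\to B)\to(\mathbf{I}A\to\mathbf{I}B)$; $\mathbf{I3}$: $\mathbf{I}(A\lor\Diamond A)\to\mathbf{I}A$; $\mathbf{I4}$: $\mathbf{I}A\land\Diamond\top\to\Diamond A$; $\mathbf{J1}^u$: $\Box A\to\mathbf{I}A$; $\mathbf{J15}^u$: $\Box(A\lor\Diamond A)\to\mathbf{I}A$; $\mathbf{J25}^u$: $\Box(A\to\Diamond B)\to(\mathbf{I}A\to\mathbf{I}B)$. $\mathbf{il}^-(\Sigma_1,\dots,\Sigma_k)$ is defined analogously. *)

(* Defs.v *)
From Stdlib Require Import Bool List.

Declare Scope il_scope.
Delimit Scope il_scope with il.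
Declare Scope ui_scope.
Delimit Scope ui_scope with ui.

Reserved Notation "⊥" (at level 0).
Reserved Notation "⊤" (at level 0).
Reserved Notation "¬ A" (at level 30, right associativity).
Reserved Notation "□ A" (at level 30, right associativity).
Reserved Notation "◇ A" (at level 30, right associativity).
Reserved Notation "'𝐈' A" (at level 30, right associativity).
Reserved Notation "A ∧ B" (at level 40, left associativity).
Reserved Notation "A ∨ B" (at level 50, left associativity).
Reserved Notation "A ▷ B" (at level 60, no associativity).
Reserved Notation "A → B" (at level 65, right associativity).
Reserved Notation "A ↔ B" (at level 66, no associativity).

(** * The language of [□] and [▷] *)

Inductive form : Set :=
| Var (p : nat)
| Bot
| Imp (A B : form)
| Box (A : form)
| Rhd (A B : form).

Bind Scope il_scope with form.

Notation "⊥" := Bot : il_scope.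
Notation "A → B" := (Imp A B) : il_scope.
Notation "□ A" := (Box A) : il_scope.
Notation "A ▷ B" := (Rhd A B) : il_scope.

Definition Neg (A : form) : form := (A → ⊥)%il.
Notation "¬ A" := (Neg A) : il_scope.
Definition Top : form := (¬ ⊥)%il.
Notation "⊤" := Top : il_scope.
Definition Or (A B : form) : form := (¬ A → B)%il.
Notation "A ∨ B" := (Or A B) : il_scope.
Definition And (A B : form) : form := (¬ (A → ¬ B))%il.
Notation "A ∧ B" := (And A B) : il_scope.
Definition Iff (A B : form) : form := ((A → B) ∧ (B → A))%il.
Notation "A ↔ B" := (Iff A B) : il_scope.
Definition Dia (A : form) : form := (¬ □ ¬ A)%il.
Notation "◇ A" := (Dia A) : il_scope.

(** Truth-functional evaluation: formulas whose outermost symbol is a modality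
    are treated as atoms, whose truth values are given by [v] like those of
    the variables. *)
Fixpoint eval (v : form -> bool) (A : form) : bool :=
  match A with
  | Bot => false
  | Imp B C => implb (eval v B) (eval v C)
  | Var _ | Box _ | Rhd _ _ => v A
  end.

Definition tautology (A : form) : Prop :=
  forall v : form -> bool, eval v A = true.

(** A schema is the set of its instances. *)
Definition J1 (F : form) : Prop :=
  exists A B, F = (□ (A → B) → A ▷ B)%il.
Definition J2 (F : form) : Prop :=
  exists A B C, F = ((A ▷ B) ∧ (B ▷ C) → A ▷ C)%il.
Definition J2plus (F : form) : Prop :=
  exists A B C, F = ((A ▷ (B ∨ C)) ∧ (B ▷ C) → A ▷ C)%il.
Definition J4 (F : form) : Prop :=
  exists A B, F = (A ▷ B → (◇ A → ◇ B))%il.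
Definition J4plus (F : form) : Prop :=
  exists A B C, F = (□ (A → B) → (C ▷ A → C ▷ B))%il.
Definition J5 (F : form) : Prop :=
  exists A, F = (◇ A ▷ A)%il.

(** [ILminus S] is the set of theorems of the extension of [𝐈𝐋⁻] by the
    schemata in [S]. *)
Inductive ILminus (S : list (form -> Prop)) : form -> Prop :=
| IL_taut A : tautology A -> ILminus S A
| IL_G2 A B : ILminus S (□ (A → B) → (□ A → □ B))%il
| IL_G3 A : ILminus S (□ (□ A → A) → □ A)%il
| IL_J3 A B C : ILminus S ((A ▷ C) ∧ (B ▷ C) → (A ∨ B) ▷ C)%il
| IL_J6 A : ILminus S (□ A ↔ (¬ A ▷ ⊥))%il
| IL_schema Sigma A : In Sigma S -> Sigma A -> ILminus S A
| IL_MP A B : ILminus S (A → B)%il -> ILminus S A -> ILminus S B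
| IL_Nec A : ILminus S A -> ILminus S (□ A)%il
| IL_R1 A B C : ILminus S (A → B)%il -> ILminus S (C ▷ A → C ▷ B)%il
| IL_R2 A B C : ILminus S (A → B)%il -> ILminus S (B ▷ C → A ▷ C)%il.

Definition CL : form -> Prop := ILminus (J1 :: J2plus :: nil).
Definition IL : form -> Prop := ILminus (J1 :: J2plus :: J5 :: nil).

(** * The language of [□] and the unary [𝐈] *)

Inductive uform : Set :=
| uVar (p : nat)
| uBot
| uImp (A B : uform)
| uBox (A : uform)
| uI (A : uform).

Bind Scope ui_scope with uform.

Notation "⊥" := uBot : ui_scope.
Notation "A → B" := (uImp A B) : ui_scope.
Notation "□ A" := (uBox A) : ui_scope.
Notation "'𝐈' A" := (uI A) : ui_scope.

Definition uNeg (A : uform) : uform := (A → ⊥)%ui.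
Notation "¬ A" := (uNeg A) : ui_scope.
Definition uTop : uform := (¬ ⊥)%ui.
Notation "⊤" := uTop : ui_scope.
Definition uOr (A B : uform) : uform := (¬ A → B)%ui.
Notation "A ∨ B" := (uOr A B) : ui_scope.
Definition uAnd (A B : uform) : uform := (¬ (A → ¬ B))%ui.
Notation "A ∧ B" := (uAnd A B) : ui_scope.
Definition uIff (A B : uform) : uform := ((A → B) ∧ (B → A))%ui.
Notation "A ↔ B" := (uIff A B) : ui_scope.
Definition uDia (A : uform) : uform := (¬ □ ¬ A)%ui.
Notation "◇ A" := (uDia A) : ui_scope.

Fixpoint ueval (v : uform -> bool) (A : uform) : bool :=
  match A with
  | uBot => false
  | uImp B C => implb (ueval v B) (ueval v C)
  | uVar _ | uBox _ | uI _ => v A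
  end.

Definition utautology (A : uform) : Prop :=
  forall v : uform -> bool, ueval v A = true.

Definition I2 (F : uform) : Prop :=
  exists A B, F = (□ (A → B) → (𝐈 A → 𝐈 B))%ui.
Definition I3 (F : uform) : Prop :=
  exists A, F = (𝐈 (A ∨ ◇ A) → 𝐈 A)%ui.
Definition I4 (F : uform) : Prop :=
  exists A, F = (𝐈 A ∧ ◇ ⊤ → ◇ A)%ui.
Definition J1u (F : uform) : Prop :=
  exists A, F = (□ A → 𝐈 A)%ui.
Definition J15u (F : uform) : Prop :=
  exists A, F = (□ (A ∨ ◇ A) → 𝐈 A)%ui.
Definition J25u (F : uform) : Prop :=
  exists A B, F = (□ (A → ◇ B) → (𝐈 A → 𝐈 B))%ui.

Inductive ilminus (S : list (uform -> Prop)) : uform -> Prop :=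
| il_taut A : utautology A -> ilminus S A
| il_G2 A B : ilminus S (□ (A → B) → (□ A → □ B))%ui
| il_G3 A : ilminus S (□ (□ A → A) → □ A)%ui
| il_J6u : ilminus S (□ ⊥ ↔ 𝐈 ⊥)%ui
| il_schema Sigma A : In Sigma S -> Sigma A -> ilminus S A
| il_MP A B : ilminus S (A → B)%ui -> ilminus S A -> ilminus S B
| il_Nec A : ilminus S A -> ilminus S (□ A)%ui
| il_Ru A B : ilminus S (A → B)%ui -> ilminus S (𝐈 A → 𝐈 B)%ui.

(** Reading [𝐈 A] as the abbreviation [⊤ ▷ A]. *)
Fixpoint expand (A : uform) : form :=
  match A with
  | uVar p => Var p
  | uBot => ⊥
  | uImp B C => expand B → expand C
  | uBox B => □ expand B
  | uI B => ⊤ ▷ expand B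
  end%il.

(* Main.v *)
(** For the direction from [L] to [ℓ], the binary modality can be eliminated
    syntactically: read [A ▷ B] as [□ (A → g B) ∨ 𝐈 B], where [g B] is the
    disjunction of [B], if J1 is an axiom of [L], and of [◇ B], if J5 is.
    Under this reading every axiom and rule of [L] becomes derivable in [ℓ].
    Moreover [ℓ] proves [□ g B → 𝐈 B], so [⊤ ▷ B] is read as an equivalent
    of [𝐈 B], and [A] is equivalent in [ℓ] to the reading of its expansion. *)

Require Import Defs.
From Stdlib Require Import List.
Import ListNotations.

Ltac destruct_atoms v :=
  repeat match goal with
         | |- context [eval v ?A] => destruct (eval v A); cbn
         | |- context [ueval v ?A] => destruct (ueval v A); cbn
         | |- context [v ?A] => destruct (v A); cbn
         end.
Ltac taut :=
  let v := fresh in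
  intro v; cbn; cbv [Iff And Or Dia Top Neg uIff uAnd uOr uDia uTop uNeg]; cbn;
  destruct_atoms v; reflexivity.

(** * Derivations in extensions of [𝐢𝐥⁻] *)

Section Unary.

Context {T : list (uform -> Prop)}.
Local Notation "⊢ A" := (ilminus T A) (at level 70, A at level 69).
Local Open Scope ui_scope.

Lemma il_cons (P Q : uform) : ⊢ P -> utautology (P → Q) -> ⊢ Q.
Proof. intros HP HQ. exact (il_MP T P Q (il_taut T _ HQ) HP). Qed.

Lemma il_cons2 (P Q R : uform) :
  ⊢ P -> ⊢ Q -> utautology (P → (Q → R)) -> ⊢ R.
Proof.
  intros HP HQ HR.
  exact (il_MP T Q R (il_MP T P _ (il_taut T _ HR) HP) HQ).
Qed.

Lemma il_cons3 (P Q R F : uform) :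
  ⊢ P -> ⊢ Q -> ⊢ R -> utautology (P → (Q → (R → F))) -> ⊢ F.
Proof.
  intros HP HQ HR HF.
  exact (il_MP T R F (il_cons2 P Q _ HP HQ HF) HR).
Qed.

Lemma il_box_mono (P Q : uform) : ⊢ P → Q -> ⊢ □ P → □ Q.
Proof. intro H. exact (il_MP T _ _ (il_G2 T P Q) (il_Nec T _ H)). Qed.

Lemma il_box_and (P Q : uform) : ⊢ □ P → (□ Q → □ (P ∧ Q)).
Proof.
  assert (H : ⊢ P → (Q → P ∧ Q)) by (apply il_taut; taut).
  apply (il_cons2 _ _ _ (il_box_mono _ _ H) (il_G2 T Q (P ∧ Q))); taut.
Qed.

(* Löb's axiom for [P ∧ □ P]. *)
Lemma il_4 (P : uform) : ⊢ □ P → □ □ P.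
Proof.
  assert (H1 : ⊢ □ (P ∧ □ P) → □ P) by (apply il_box_mono, il_taut; taut).
  assert (H2 : ⊢ □ (P ∧ □ P) → □ □ P) by (apply il_box_mono, il_taut; taut).
  assert (H3 : ⊢ P → (□ (P ∧ □ P) → P ∧ □ P))
    by (apply (il_cons _ _ H1); taut).
  apply (il_cons3 _ _ _ _ (il_box_mono _ _ H3) (il_G3 T (P ∧ □ P)) H2); taut.
Qed.

(** By transitivity [□ P] gives [□ (P ∧ □ P)], so under the box the premise may be used both bare
    and boxed. *)
Lemma il_box_4 (P Q : uform) : ⊢ P ∧ □ P → Q -> ⊢ □ P → □ Q.
Proof.
  intro H.
  apply (il_cons3 _ _ _ _ (il_box_mono _ _ H) (il_4 P) (il_box_and P (□ P))).
  taut.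
Qed.

Lemma il_box2_4 (P Q R : uform) :
  ⊢ P ∧ Q → (□ P → (□ Q → R)) -> ⊢ □ P → (□ Q → □ R).
Proof.
  intro H.
  assert (H1 : ⊢ □ (P ∧ Q) → □ P) by (apply il_box_mono, il_taut; taut).
  assert (H2 : ⊢ □ (P ∧ Q) → □ Q) by (apply il_box_mono, il_taut; taut).
  assert (H3 : ⊢ (P ∧ Q) ∧ □ (P ∧ Q) → R)
    by (apply (il_cons3 _ _ _ _ H H1 H2); taut).
  apply (il_cons2 _ _ _ (il_box_4 _ _ H3) (il_box_and P Q)); taut.
Qed.

Lemma il_box_bot (P : uform) : ⊢ □ ⊥ → 𝐈 P.
Proof.
  assert (H : ⊢ 𝐈 ⊥ → 𝐈 P) by (apply il_Ru, il_taut; taut).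
  apply (il_cons2 _ _ _ H (il_J6u T)); taut.
Qed.

(** A formalized second incompleteness theorem: [◇ P] refutes [□ ⊥], so [□ ◇ P] gives [□ (□ ⊥ → ⊥)],
    and Löb's axiom applies. *)
Lemma il_box_dia (P : uform) : ⊢ □ ◇ P → □ ⊥.
Proof.
  assert (H : ⊢ □ ⊥ → □ ¬ P) by (apply il_box_mono, il_taut; taut).
  assert (H' : ⊢ ◇ P → (□ ⊥ → ⊥)) by (apply (il_cons _ _ H); taut).
  apply (il_cons2 _ _ _ (il_box_mono _ _ H') (il_G3 T ⊥)); taut.
Qed.

Lemma il_dia_bot : ⊢ ¬ ◇ ⊥.
Proof.
  assert (H : ⊢ ¬ ⊥) by (apply il_taut; taut).
  apply (il_cons _ _ (il_Nec T _ H)); taut.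
Qed.

(** * The formula [g B], with its disjuncts [B] and [◇ B] switched on by [r] and [d] *)

Definition reach (r d : bool) (B : uform) : uform :=
  (if r then B else ⊥) ∨ (if d then ◇ B else ⊥).

Lemma reach_bot (r d : bool) : ⊢ ¬ reach r d ⊥.
Proof. destruct r, d; apply (il_cons _ _ il_dia_bot); taut. Qed.

(** The bare implication serves the disjunct [A], the boxed one serves [◇ A]; [il_box2_4] supplies
    both. *)
Lemma reach_box (r d : bool) (A B : uform) :
  ⊢ (A → B) → (□ (A → B) → (reach r d A → reach r d B)).
Proof.
  assert (H : ⊢ □ (A → B) → (□ ¬ B → □ ¬ A))
    by (apply il_box2_4, il_taut; taut).
  destruct r, d; apply (il_cons _ _ H); taut.
Qed.

Lemma reach_mono (r d : bool) (A B : uform) :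
  ⊢ A → B -> ⊢ reach r d A → reach r d B.
Proof.
  intro H.
  apply (il_cons3 _ _ _ _ (reach_box r d A B) H (il_Nec T _ H)); taut.
Qed.

Lemma reach_dia (r d : bool) (B : uform) : ⊢ □ ¬ B → □ ¬ reach r d B.
Proof. apply il_box_4, il_taut. destruct r, d; taut. Qed.

(** A disjunct [B ∨ C] is settled by the premise. For [◇ (B ∨ C)] contrapose: under [□ ¬ C], every
    accessible point has [¬ C] and [□ ¬ C], so [reach r d C] fails there, and with it [B]. *)
Lemma reach_or (r d : bool) (B C : uform) :
  ⊢ □ (B → reach r d C) → □ (reach r d (B ∨ C) → reach r d C).
Proof.
  apply il_box_4.
  assert (H : ⊢ □ (B → reach r d C) → (□ ¬ C → □ ¬ (B ∨ C)))
    by (apply il_box2_4, il_taut; destruct r, d; taut).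
  destruct r, d; apply (il_cons _ _ H); taut.
Qed.

Lemma reach_trans (r d : bool) (B C : uform) :
  ⊢ □ (B → reach r d C) → □ (reach r d B → reach r d C).
Proof.
  assert (H : ⊢ reach r d B → reach r d (B ∨ C))
    by (apply reach_mono, il_taut; taut).
  assert (H' : ⊢ □ (reach r d (B ∨ C) → reach r d C) →
                 □ (reach r d B → reach r d C))
    by (apply il_box_mono, (il_cons _ _ H); taut).
  apply (il_cons2 _ _ _ (reach_or r d B C) H'); taut.
Qed.

(** * The reading of [▷] and its soundness for the axioms and rules of [𝐈𝐋⁻] *)

Definition rhd (r d : bool) (A B : uform) : uform :=
  □ (A → reach r d B) ∨ 𝐈 B.

Fixpoint contract (r d : bool) (A : form) : uform :=
  match A with
  | Var p => uVar p
  | Bot => ⊥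
  | Imp B C => contract r d B → contract r d C
  | Box B => □ contract r d B
  | Rhd B C => rhd r d (contract r d B) (contract r d C)
  end.

(** [A ▷ B] is an atom but its reading is a disjunction; the valuation giving each atom the truth
    value of its reading bridges the two. *)
Lemma contract_tautology (r d : bool) (A : form) :
  tautology A -> utautology (contract r d A).
Proof.
  intros HA v.
  rewrite <- (HA (fun B => ueval v (contract r d B))).
  clear HA; induction A; cbn; try reflexivity.
  now rewrite IHA1, IHA2.
Qed.

Lemma rhd_J3 (r d : bool) (A B C : uform) :
  ⊢ rhd r d A C ∧ rhd r d B C → rhd r d (A ∨ B) C.
Proof.
  assert (H : ⊢ □ (A → reach r d C) →
                (□ (B → reach r d C) → □ (A ∨ B → reach r d C)))
    by (apply il_box2_4, il_taut; taut).
  apply (il_cons _ _ H); taut.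
Qed.

(** Since [reach r d ⊥] is refutable, the box disjunct amounts to [□ A]; the other one, [𝐈 ⊥], is
    [□ ⊥] by J6u and implies [□ A]. *)
Lemma rhd_J6 (r d : bool) (A : uform) : ⊢ □ A ↔ rhd r d (¬ A) ⊥.
Proof.
  assert (H1 : ⊢ □ A → □ (¬ A → reach r d ⊥))
    by (apply il_box_mono, il_taut; taut).
  assert (H2 : ⊢ □ (¬ A → reach r d ⊥) → □ A)
    by (apply il_box_mono, (il_cons _ _ (reach_bot r d)); taut).
  assert (H3 : ⊢ □ ⊥ → □ A) by (apply il_box_mono, il_taut; taut).
  assert (H4 : ⊢ □ A ↔ □ (¬ A → reach r d ⊥))
    by (apply (il_cons2 _ _ _ H1 H2); taut).
  apply (il_cons3 _ _ _ _ H4 H3 (il_J6u T)); taut.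
Qed.

Lemma rhd_R1 (r d : bool) (A B C : uform) :
  ⊢ A → B -> ⊢ rhd r d C A → rhd r d C B.
Proof.
  intro H.
  assert (H1 : ⊢ □ (C → reach r d A) → □ (C → reach r d B))
    by (apply il_box_mono, (il_cons _ _ (reach_mono r d A B H)); taut).
  apply (il_cons2 _ _ _ H1 (il_Ru T _ _ H)); taut.
Qed.

Lemma rhd_R2 (r d : bool) (A B C : uform) :
  ⊢ A → B -> ⊢ rhd r d B C → rhd r d A C.
Proof.
  intro H.
  assert (H1 : ⊢ □ (B → reach r d C) → □ (A → reach r d C))
    by (apply il_box_mono, (il_cons _ _ H); taut).
  apply (il_cons _ _ H1); taut.
Qed.

Definition sound (r d : bool) (Sigma : form -> Prop) : Prop :=
  forall A, Sigma A -> ⊢ contract r d A.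

Lemma contract_sound (r d : bool) (S : list (form -> Prop)) (A : form) :
  Forall (sound r d) S -> ILminus S A -> ⊢ contract r d A.
Proof.
  intros HS HA; induction HA; cbn.
  - now apply il_taut, contract_tautology.
  - apply il_G2.
  - apply il_G3.
  - apply rhd_J3.
  - apply rhd_J6.
  - rewrite Forall_forall in HS. exact (HS _ H _ H0).
  - exact (il_MP T _ _ IHHA1 IHHA2).
  - now apply il_Nec.
  - now apply rhd_R1.
  - now apply rhd_R2.
Qed.

Lemma contract_expand (r d : bool) (A : uform) :
  (forall B, ⊢ □ reach r d B → 𝐈 B) -> ⊢ contract r d (expand A) ↔ A.
Proof.
  intro Htop; induction A; cbn.
  - apply il_taut; taut.
  - apply il_taut; taut.
  - apply (il_cons2 _ _ _ IHA1 IHA2); taut.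
  - set (A' := contract r d (expand A)) in *.
    assert (H1 : ⊢ □ A' → □ A)
      by (apply il_box_mono, (il_cons _ _ IHA); taut).
    assert (H2 : ⊢ □ A → □ A')
      by (apply il_box_mono, (il_cons _ _ IHA); taut).
    apply (il_cons2 _ _ _ H1 H2); taut.
  - set (A' := contract r d (expand A)) in *.
    assert (H1 : ⊢ 𝐈 A' → 𝐈 A) by (apply il_Ru, (il_cons _ _ IHA); taut).
    assert (H2 : ⊢ 𝐈 A → 𝐈 A') by (apply il_Ru, (il_cons _ _ IHA); taut).
    (* The box disjunct in the reading of [⊤ ▷ expand A] is absorbed into [𝐈 A'] by [Htop]. *)
    assert (H3 : ⊢ □ (⊤ → reach r d A') → □ reach r d A')
      by (apply il_box_mono, il_taut; taut).
    assert (H4 : ⊢ □ (⊤ → reach r d A') → 𝐈 A')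
      by (apply (il_cons2 _ _ _ H3 (Htop A')); taut).
    apply (il_cons3 _ _ _ _ H1 H2 H4); taut.
Qed.

(** * The law [□ g B → 𝐈 B] for each choice of disjuncts *)

Lemma reach_top_none (B : uform) : ⊢ □ reach false false B → 𝐈 B.
Proof.
  assert (H : ⊢ □ reach false false B → □ ⊥)
    by (apply il_box_mono, il_taut; taut).
  apply (il_cons2 _ _ _ H (il_box_bot B)); taut.
Qed.

Lemma reach_top_dia (B : uform) : ⊢ □ reach false true B → 𝐈 B.
Proof.
  assert (H : ⊢ □ reach false true B → □ ◇ B)
    by (apply il_box_mono, il_taut; taut).
  apply (il_cons3 _ _ _ _ H (il_box_dia B) (il_box_bot B)); taut.
Qed.

Lemma reach_top_J1u (B : uform) : In J1u T -> ⊢ □ reach true false B → 𝐈 B.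
Proof.
  intro HT.
  assert (H : ⊢ □ reach true false B → □ B)
    by (apply il_box_mono, il_taut; taut).
  assert (HJ : ⊢ □ B → 𝐈 B) by (apply (il_schema T J1u); [|exists B]; easy).
  apply (il_cons2 _ _ _ H HJ); taut.
Qed.

Lemma reach_top_J15u (B : uform) : In J15u T -> ⊢ □ reach true true B → 𝐈 B.
Proof.
  intro HT. apply (il_schema T J15u); [|exists B]; easy.
Qed.

(** This derives J15u: J1u is taken at [B ∨ ◇ B], and I3 then drops [◇ B]. *)
Lemma reach_top_I3 (B : uform) :
  In J1u T -> In I3 T -> ⊢ □ reach true true B → 𝐈 B.
Proof.
  intros HT HT'. change (⊢ □ (B ∨ ◇ B) → 𝐈 B).
  assert (HJ : ⊢ □ (B ∨ ◇ B) → 𝐈 (B ∨ ◇ B))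
    by (apply (il_schema T J1u); [|exists (B ∨ ◇ B)]; easy).
  assert (HI : ⊢ 𝐈 (B ∨ ◇ B) → 𝐈 B)
    by (apply (il_schema T I3); [|exists B]; easy).
  apply (il_cons2 _ _ _ HJ HI); taut.
Qed.

(** * The schemata of [L] under the reading *)

Lemma sound_J1 (d : bool) : sound true d J1.
Proof.
  intros F (A & B & ->); cbn.
  generalize (contract true d A) (contract true d B); clear A B; intros A B.
  assert (H : ⊢ □ (A → B) → □ (A → reach true d B))
    by (apply il_box_mono, il_taut; taut).
  apply (il_cons _ _ H); taut.
Qed.

Lemma sound_J5 (r : bool) : sound r true J5.
Proof.
  intros F (A & ->); cbn.
  generalize (contract r true A); clear A; intro A.
  assert (H : ⊢ ◇ A → reach r true A) by (apply il_taut; taut).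
  apply (il_cons _ _ (il_Nec T _ H)); taut.
Qed.

Lemma il_I2 (A B : uform) : In I2 T -> ⊢ □ (A → B) → (𝐈 A → 𝐈 B).
Proof. intro HT. apply (il_schema T I2); [|exists A, B]; easy. Qed.

Lemma il_I4 (A : uform) : In I4 T -> ⊢ 𝐈 A ∧ ◇ ⊤ → ◇ A.
Proof. intro HT. apply (il_schema T I4); [|exists A]; easy. Qed.

Lemma sound_J4plus (r d : bool) : In I2 T -> sound r d J4plus.
Proof.
  intros HT F (A & B & C & ->); cbn.
  generalize (contract r d A) (contract r d B) (contract r d C).
  clear A B C; intros A B C.
  assert (H : ⊢ □ (A → B) → (□ (C → reach r d A) → □ (C → reach r d B)))
    by (apply il_box2_4, (il_cons _ _ (reach_box r d A B)); taut).
  apply (il_cons2 _ _ _ H (il_I2 A B HT)); taut.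
Qed.

(** If [A ▷ B] holds by its box disjunct, contraposition and [reach_dia] suffice. If it holds by
    [𝐈 B], then [◇ A] gives [◇ ⊤] and I4 applies. *)
Lemma sound_J4 (r d : bool) : In I4 T -> sound r d J4.
Proof.
  intros HT F (A & B & ->); cbn.
  generalize (contract r d A) (contract r d B); clear A B; intros A B.
  assert (H : ⊢ □ (A → reach r d B) → (□ ¬ reach r d B → □ ¬ A))
    by (apply il_box2_4, il_taut; taut).
  assert (H0 : ⊢ □ ¬ ⊤ → □ ¬ A) by (apply il_box_mono, il_taut; taut).
  assert (H1 : ⊢ 𝐈 B → (◇ A → ◇ B))
    by (apply (il_cons2 _ _ _ H0 (il_I4 B HT)); taut).
  apply (il_cons3 _ _ _ _ H (reach_dia r d B) H1); taut.
Qed.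

(** Two box disjuncts compose by [reach_trans], and [𝐈 C] in the second premise is already the goal.
    The remaining case, [𝐈 B] with a box, is the hypothesis, which depends on the schemata of
    [ℓ]. *)
Lemma sound_J2 (r d : bool) :
  (forall B C, ⊢ □ (B → reach r d C) → (𝐈 B → 𝐈 C)) -> sound r d J2.
Proof.
  intros HI F (A & B & C & ->); cbn.
  generalize (contract r d A) (contract r d B) (contract r d C).
  clear A B C; intros A B C.
  assert (H : ⊢ □ (A → reach r d B) →
                (□ (reach r d B → reach r d C) → □ (A → reach r d C)))
    by (apply il_box2_4, il_taut; taut).
  apply (il_cons3 _ _ _ _ H (reach_trans r d B C) (HI B C)); taut.
Qed.

Lemma sound_J2plus (r d : bool) :
  (forall B C, ⊢ □ (B → reach r d C) → (𝐈 (B ∨ C) → 𝐈 C)) ->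
  sound r d J2plus.
Proof.
  intros HI F (A & B & C & ->); cbn.
  generalize (contract r d A) (contract r d B) (contract r d C).
  clear A B C; intros A B C.
  assert (H : ⊢ □ (A → reach r d (B ∨ C)) →
                (□ (reach r d (B ∨ C) → reach r d C) → □ (A → reach r d C)))
    by (apply il_box2_4, il_taut; taut).
  apply (il_cons3 _ _ _ _ H (reach_or r d B C) (HI B C)); taut.
Qed.

(** Without the disjunct [◇ C], [g C] implies [C], so I2 can be used with [B ∨ C → C]. *)
Lemma reach_I_I2 (r : bool) (B C : uform) :
  In I2 T -> ⊢ □ (B → reach r false C) → (𝐈 (B ∨ C) → 𝐈 C).
Proof.
  intro HT.
  assert (H : ⊢ □ (B → reach r false C) → □ (B ∨ C → C))
    by (apply il_box_mono, il_taut; destruct r; taut).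
  apply (il_cons2 _ _ _ H (il_I2 (B ∨ C) C HT)); taut.
Qed.

Lemma reach_I_I3 (r : bool) (B C : uform) :
  In I2 T -> In I3 T -> ⊢ □ (B → reach r true C) → (𝐈 (B ∨ C) → 𝐈 C).
Proof.
  intros HT HT'.
  assert (H : ⊢ □ (B → reach r true C) → □ (B ∨ C → C ∨ ◇ C))
    by (apply il_box_mono, il_taut; destruct r; taut).
  assert (HI : ⊢ 𝐈 (C ∨ ◇ C) → 𝐈 C)
    by (apply (il_schema T I3); [|exists C]; easy).
  apply (il_cons3 _ _ _ _ H (il_I2 (B ∨ C) (C ∨ ◇ C) HT) HI); taut.
Qed.

Lemma reach_I_I2_none (B C : uform) :
  In I2 T -> ⊢ □ (B → reach false false C) → (𝐈 B → 𝐈 C).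
Proof.
  intro HT.
  assert (H : ⊢ 𝐈 B → 𝐈 (B ∨ C)) by (apply il_Ru, il_taut; taut).
  apply (il_cons2 _ _ _ H (reach_I_I2 false B C HT)); taut.
Qed.

(** With both disjuncts off the premise says [□ ¬ B]. By I4, [𝐈 B] then excludes [◇ ⊤], and [□ ⊥]
    yields [𝐈 C]. *)
Lemma reach_I_I4 (B C : uform) :
  In I4 T -> ⊢ □ (B → reach false false C) → (𝐈 B → 𝐈 C).
Proof.
  intro HT.
  assert (H : ⊢ □ (B → reach false false C) → □ ¬ B)
    by (apply il_box_mono, il_taut; taut).
  assert (H0 : ⊢ □ ¬ ⊤ → □ ⊥) by (apply il_box_mono, il_taut; taut).
  assert (H1 : ⊢ □ ¬ ⊤ → 𝐈 C)
    by (apply (il_cons2 _ _ _ H0 (il_box_bot C)); taut).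
  apply (il_cons3 _ _ _ _ H H1 (il_I4 B HT)); taut.
Qed.

Lemma reach_I_J25u (B C : uform) :
  In J25u T -> ⊢ □ (B → reach false true C) → (𝐈 B → 𝐈 C).
Proof.
  intro HT.
  assert (H : ⊢ □ (B → reach false true C) → □ (B → ◇ C))
    by (apply il_box_mono, il_taut; taut).
  assert (HJ : ⊢ □ (B → ◇ C) → (𝐈 B → 𝐈 C))
    by (apply (il_schema T J25u); [|exists B, C]; easy).
  apply (il_cons2 _ _ _ H HJ); taut.
Qed.

End Unary.

(** * Derivations in extensions of [𝐈𝐋⁻] *)

Section Binary.

Context {S : list (form -> Prop)}.
Local Notation "⊢ A" := (ILminus S A) (at level 70, A at level 69).
Local Open Scope il_scope.

Lemma IL_cons (P Q : form) : ⊢ P -> tautology (P → Q) -> ⊢ Q.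
Proof. intros HP HQ. exact (IL_MP S P Q (IL_taut S _ HQ) HP). Qed.

Lemma IL_cons2 (P Q R : form) :
  ⊢ P -> ⊢ Q -> tautology (P → (Q → R)) -> ⊢ R.
Proof.
  intros HP HQ HR.
  exact (IL_MP S Q R (IL_MP S P _ (IL_taut S _ HR) HP) HQ).
Qed.

Lemma IL_cons3 (P Q R F : form) :
  ⊢ P -> ⊢ Q -> ⊢ R -> tautology (P → (Q → (R → F))) -> ⊢ F.
Proof.
  intros HP HQ HR HF.
  exact (IL_MP S R F (IL_cons2 P Q _ HP HQ HF) HR).
Qed.

Lemma IL_box_mono (P Q : form) : ⊢ P → Q -> ⊢ □ P → □ Q.
Proof. intro H. exact (IL_MP S _ _ (IL_G2 S P Q) (IL_Nec S _ H)). Qed.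

(** J6 turns [□ ¬ A] into [¬ ¬ A ▷ ⊥]; R2 removes the double negation and R1 weakens [⊥] to [B]. *)
Lemma IL_box_rhd (P A B : form) : tautology (P → ¬ A) -> ⊢ □ P → A ▷ B.
Proof.
  intro HP.
  assert (H : ⊢ P → ¬ A) by (apply IL_taut, HP).
  assert (H1 : ⊢ ¬ ¬ A ▷ ⊥ → A ▷ ⊥) by (apply IL_R2, IL_taut; taut).
  assert (H2 : ⊢ A ▷ ⊥ → A ▷ B) by (apply IL_R1, IL_taut; taut).
  assert (H3 : ⊢ □ ¬ A → A ▷ B)
    by (apply (IL_cons3 _ _ _ _ H1 H2 (IL_J6 S (¬ A))); taut).
  apply (IL_cons2 _ _ _ (IL_box_mono _ _ H) H3); taut.
Qed.

(** An internal form of R2: [A] is covered by [A ∧ ¬ B], which the boxed implication makes vacuous,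
    and [B]; J3 joins the two. *)
Lemma IL_rhd_box_or (A B C : form) : ⊢ □ (A → B) → (B ▷ C → A ▷ C).
Proof.
  assert (H : ⊢ □ (A → B) → (A ∧ ¬ B) ▷ C) by (apply IL_box_rhd; taut).
  assert (H1 : ⊢ ((A ∧ ¬ B) ∨ B) ▷ C → A ▷ C) by (apply IL_R2, IL_taut; taut).
  apply (IL_cons3 _ _ _ _ H H1 (IL_J3 S (A ∧ ¬ B) B C)); taut.
Qed.

Lemma IL_J1 (A B : form) : In J1 S -> ⊢ □ (A → B) → A ▷ B.
Proof. intro HS. apply (IL_schema S J1); [|exists A, B]; easy. Qed.

Lemma IL_J2 (A B C : form) : In J2 S -> ⊢ (A ▷ B) ∧ (B ▷ C) → A ▷ C.
Proof. intro HS. apply (IL_schema S J2); [|exists A, B, C]; easy. Qed.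

Lemma IL_J2plus (A B C : form) :
  In J2plus S -> ⊢ (A ▷ (B ∨ C)) ∧ (B ▷ C) → A ▷ C.
Proof. intro HS. apply (IL_schema S J2plus); [|exists A, B, C]; easy. Qed.

Lemma IL_J5 (A : form) : In J5 S -> ⊢ ◇ A ▷ A.
Proof. intro HS. apply (IL_schema S J5); [|exists A]; easy. Qed.

(** * The schemata of [ℓ] under expansion *)

Definition usound (Sigma : uform -> Prop) : Prop :=
  forall A, Sigma A -> ⊢ expand A.

Lemma expand_sound (T : list (uform -> Prop)) (A : uform) :
  Forall usound T -> ilminus T A -> ⊢ expand A.
Proof.
  intros HT HA; induction HA; cbn.
  - apply IL_taut; intro v.
    rewrite <- (H (fun B => eval v (expand B))).
    clear; induction A; cbn; try reflexivity.
    now rewrite IHA1, IHA2.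
  - apply IL_G2.
  - apply IL_G3.
  (* [⊤] is by definition [¬ ⊥], so J6u expands to this instance of J6. *)
  - apply (IL_J6 S ⊥).
  - rewrite Forall_forall in HT. exact (HT _ H _ H0).
  - exact (IL_MP S _ _ IHHA1 IHHA2).
  - now apply IL_Nec.
  - now apply IL_R1.
Qed.

Lemma usound_J1u : In J1 S -> usound J1u.
Proof.
  intros HS F (A & ->); cbn.
  generalize (expand A); clear A; intro A.
  assert (H : ⊢ □ A → □ (⊤ → A)) by (apply IL_box_mono, IL_taut; taut).
  apply (IL_cons2 _ _ _ H (IL_J1 ⊤ A HS)); taut.
Qed.

(** J1 gives [A ▷ A] and J5 gives [◇ A ▷ A]; J3 joins them, and [□ (A ∨ ◇ A)] lets [⊤] replace the
    antecedent. *)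
Lemma usound_J15u : In J1 S -> In J5 S -> usound J15u.
Proof.
  intros HS HS' F (A & ->); cbn.
  generalize (expand A); clear A; intro A.
  assert (H : ⊢ □ (A → A)) by (apply IL_Nec, IL_taut; taut).
  assert (H1 : ⊢ (A ∨ ◇ A) ▷ A)
    by (apply (IL_MP S _ _ (IL_J3 S A (◇ A) A)),
          (IL_cons3 _ _ _ _ H (IL_J1 A A HS) (IL_J5 A HS')); taut).
  assert (H2 : ⊢ □ (A ∨ ◇ A) → □ (⊤ → A ∨ ◇ A))
    by (apply IL_box_mono, IL_taut; taut).
  apply (IL_cons3 _ _ _ _ H1 H2 (IL_rhd_box_or ⊤ (A ∨ ◇ A) A)); taut.
Qed.

Lemma usound_I2_J4plus : In J4plus S -> usound I2.
Proof.
  intros HS F (A & B & ->); cbn.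
  apply (IL_schema S J4plus); [easy|].
  now exists (expand A), (expand B), ⊤.
Qed.

(** Weaken [A] to [(A ∧ ¬ B) ∨ B]; under [□ (A → B)] the first disjunct is vacuous, and J2plus cuts
    it away. *)
Lemma usound_I2_J2plus : In J2plus S -> usound I2.
Proof.
  intros HS F (A & B & ->); cbn.
  generalize (expand A) (expand B); clear A B; intros A B.
  assert (H : ⊢ □ (A → B) → (A ∧ ¬ B) ▷ B) by (apply IL_box_rhd; taut).
  assert (H1 : ⊢ ⊤ ▷ A → ⊤ ▷ ((A ∧ ¬ B) ∨ B)) by (apply IL_R1, IL_taut; taut).
  apply (IL_cons3 _ _ _ _ H H1 (IL_J2plus ⊤ (A ∧ ¬ B) B HS)); taut.
Qed.

Lemma usound_I3 : In J2plus S -> In J5 S -> usound I3.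
Proof.
  intros HS HS' F (A & ->); cbn.
  generalize (expand A); clear A; intro A.
  assert (H : ⊢ ⊤ ▷ (A ∨ ◇ A) → ⊤ ▷ (◇ A ∨ A)) by (apply IL_R1, IL_taut; taut).
  apply (IL_cons3 _ _ _ _ H (IL_J5 A HS') (IL_J2plus ⊤ (◇ A) A HS)); taut.
Qed.

Lemma usound_I4_J4 : In J4 S -> usound I4.
Proof.
  intros HS F (A & ->); cbn.
  generalize (expand A); clear A; intro A.
  assert (H : ⊢ ⊤ ▷ A → (◇ ⊤ → ◇ A))
    by (apply (IL_schema S J4); [|exists ⊤, A]; easy).
  apply (IL_cons _ _ H); taut.
Qed.

(** [□ ¬ A] gives [A ▷ ⊥], so J2 yields [⊤ ▷ ⊥], which by J6 contradicts [◇ ⊤]. *)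
Lemma usound_I4_J2 : In J2 S -> usound I4.
Proof.
  intros HS F (A & ->); cbn.
  generalize (expand A); clear A; intro A.
  assert (H : ⊢ □ ¬ A → A ▷ ⊥) by (apply IL_box_rhd; taut).
  assert (H0 : ⊢ □ ⊥ → □ ¬ ⊤) by (apply IL_box_mono, IL_taut; taut).
  assert (H1 : ⊢ ⊤ ▷ ⊥ → □ ¬ ⊤)
    by (apply (IL_cons2 _ _ _ H0 (IL_J6 S ⊥)); taut).
  apply (IL_cons3 _ _ _ _ H (IL_J2 ⊤ A ⊥ HS) H1); taut.
Qed.

(** The boxed implication carries J5, [◇ B ▷ B], over to [A ▷ B], and J2 composes this with
    [⊤ ▷ A]. *)
Lemma usound_J25u : In J2 S -> In J5 S -> usound J25u.
Proof.
  intros HS HS' F (A & B & ->); cbn.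
  generalize (expand A) (expand B); clear A B; intros A B.
  apply (IL_cons3 _ _ _ _ (IL_rhd_box_or A (◇ B) B) (IL_J5 B HS')
           (IL_J2 ⊤ A B HS)); taut.
Qed.

End Binary.

(** * Both translations combined, and the individual pairs *)

Lemma expand_conservative (r d : bool)
    (S : list (form -> Prop)) (T : list (uform -> Prop)) :
  (forall B, ilminus T (□ reach r d B → 𝐈 B)%ui) ->
  Forall (@sound T r d) S -> Forall (@usound S) T ->
  forall A, ILminus S (expand A) <-> ilminus T A.
Proof.
  intros Htop HS HT A; split; intro H.
  - apply (il_cons2 _ _ _ (contract_expand r d A Htop)
             (contract_sound r d S _ HS H)); taut.
  - exact (expand_sound T A HT H).
Qed.

Create HintDb interpretability.
#[local] Hint Resolve in_eq in_cons Forall_nil Forall_cons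
  reach_top_none reach_top_dia reach_top_J1u reach_top_J15u reach_top_I3
  reach_I_I2 reach_I_I3 reach_I_I2_none reach_I_I4 reach_I_J25u
  sound_J1 sound_J5 sound_J4plus sound_J4 sound_J2 sound_J2plus
  usound_J1u usound_J15u usound_I2_J4plus usound_I2_J2plus usound_I3
  usound_I4_J4 usound_I4_J2 usound_J25u : interpretability.

(* [r] and [d] say whether J1 and J5, respectively, are axioms of [L]. *)
Ltac conservative r d :=
  apply (expand_conservative r d); auto 8 with interpretability.

Theorem theorem3p5 :
  forall (L : form -> Prop) (l : uform -> Prop),
  In (L, l)
    [ (* 1 *)
      (ILminus [], ilminus []);
      (ILminus [J5], ilminus []);
      (* 2 *)
      (ILminus [J1], ilminus [J1u]);
      (* 3 *)
      (ILminus [J4plus], ilminus [I2]);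
      (ILminus [J4plus; J5], ilminus [I2]);
      (ILminus [J2plus], ilminus [I2]);
      (ILminus [J2; J4plus], ilminus [I2]);
      (* 4 *)
      (ILminus [J1; J5], ilminus [J15u]);
      (* 5 *)
      (ILminus [J1; J4plus], ilminus [J1u; I2]);
      (CL, ilminus [J1u; I2]);
      (* 6 *)
      (ILminus [J1; J4plus; J5], ilminus [J15u; I2]);
      (* 7 *)
      (ILminus [J2plus; J5], ilminus [I2; I3]);
      (* 8 *)
      (IL, ilminus [J1u; I2; I3]);
      (* 9 *)
      (ILminus [J4], ilminus [I4]);
      (ILminus [J4; J5], ilminus [I4]);
      (ILminus [J2], ilminus [I4]);
      (* 10 *)
      (ILminus [J1; J4], ilminus [J1u; I4]);
      (* 11 *)
      (ILminus [J1; J4; J5], ilminus [J15u; I4]);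
      (* 12 *)
      (ILminus [J2; J5], ilminus [J25u; I4]);
      (* 13 *)
      (ILminus [J2; J4plus; J5], ilminus [I2; J25u]) ] ->
  forall A : uform, L (expand A) <-> l A.
Proof.
  intros L l H.
  repeat destruct H as [[= <- <-] | H]; [.. | destruct H].
  - conservative false false.
  - conservative false true.
  - conservative true false.
  - conservative false false.
  - conservative false true.
  - conservative false false.
  - conservative false false.
  - conservative true true.
  - conservative true false.
  - conservative true false.
  - conservative true true.
  - conservative false true.
  - conservative true true.
  - conservative false false.
  - conservative false true.
  - conservative false false.
  - conservative true false.
  - conservative true true.
  - conservative false true.
  - conservative false true.
Qed.
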